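(* Let $k,n\ge1$ be integers, $\lambda\in(0,\infty)$, and $\mu_1,\dots,\mu_n\in[0,\lambda)$. Put $$\varepsilon_i:=\lambda-\mu_i,\qquad \varepsilon^{(n)}:=\frac{1}{\frac1{\varepsilon_1}+\dots+\frac1{\varepsilon_n}}.$$ Then for every real number $\varepsilon^\diamond<\varepsilon^{(n)}$ there exist a unit vector $\mathbf{e}\in\mathbb{R}^k$ and probability densities $p_1,\dots,p_n$ on $\mathbb{R}^k$ (with respect to Lebesgue measure) such that for each $i\in\{1,\dots,n\}$ $$\int_{\mathbb{R}^k}e^{\lambda\,\mathbf{e}\mathbf{x}}p_i(\mathbf{x})\,d\mathbf{x}<\infty\quad\text{and, for some }C_i\in(0,\infty),\quad p_i(\mathbf{x})\le C_i\,e^{-\mu_i\,\mathbf{e}\mathbf{x}}\ \text{ for all }\mathbf{x}\in\mathbb{R}^k,$$ but there is no finite constant $K$ such that $$(p_1*\dots*p_n)(\mathbf{x})\le K\,e^{-(\lambda-\varepsilon^\diamond)\,\mathbf{e}\mathbf{x}}\quad\text{for all }\mathbf{x}\in\mathbb{R}^k.$$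
   Context: For $\mathbf{e},\mathbf{x}\in\mathbb{R}^k$, the juxtaposition $\mathbf{e}\mathbf{x}$ denotes the Euclidean scalar product. Convolution of densities is defined pointwise by $(p*q)(\mathbf{x})=\int_{\mathbb{R}^k}p(\mathbf{x}-\mathbf{u})q(\mathbf{u})\,d\mathbf{u}$; for $n=1$ the convolution $p_1*\dots*p_n$ is $p_1$. *)

(* Defs.v *)
From HB Require Import structures.
From mathcomp Require Import all_boot all_order all_algebra.
From mathcomp Require Import all_classical all_reals all_analysis.

Set Implicit Arguments.
Unset Strict Implicit.
Unset Printing Implicit Defensive.

Import Order.TTheory GRing.Theory Num.Theory.
Import numFieldNormedType.Exports.

Local Open Scope classical_set_scope.
Local Open Scope ring_scope.
Local Open Scope ereal_scope.

(* R^k is k.-tuple (measurableTypeR R): the library equips tuples with the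
   product sigma-algebra, that is, here, the Borel sigma-algebra of R^k. *)
Notation "'Rn[ R ]_ k" := (k.-tuple (measurableTypeR R))
  (at level 0, k at level 2, format "''Rn[' R ]_ k").

Section tcons.
Context (R : realType) (k : nat).

Definition tcons (z : measurableTypeR R * 'Rn[R]_k) : 'Rn[R]_k.+1 :=
  [tuple of z.1 :: z.2].

Definition tuncons (t : 'Rn[R]_k.+1) : measurableTypeR R * 'Rn[R]_k :=
  (tnth t ord0, [tuple of behead t]).

Lemma tconsK : cancel tcons tuncons.
Proof. by case=> a t; congr pair; apply: val_inj. Qed.

Lemma tunconsK : cancel tuncons tcons.
Proof. by move=> t; rewrite [RHS]tuple_eta. Qed.

Lemma measurable_tcons : measurable_fun setT tcons.
Proof. exact: measurable_cons. Qed.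

Lemma measurable_tuncons : measurable_fun setT tuncons.
Proof.
apply/measurable_fun_pairP; split; first exact: measurable_tnth.
exact: measurable_behead.
Qed.

Lemma preimage_tunconsK X : tcons @^-1` (tuncons @^-1` X) = X.
Proof. by apply/funext => z; rewrite /preimage/= tconsK. Qed.

Lemma measurable_preimage_tuncons X :
  measurable X -> measurable (tuncons @^-1` X).
Proof.
by move=> mX; rewrite -[X in measurable X]setTI; exact: measurable_tuncons.
Qed.

End tcons.
Arguments tcons {R k}.
Arguments tuncons {R k}.

Section cons_measure.
Context (R : realType) (k : nat).
Variable m : {sigma_finite_measure set 'Rn[R]_k -> \bar R}.

Definition cons_measure : set 'Rn[R]_k.+1 -> \bar R :=
  pushforward ((@lebesgue_measure R) \x m) tcons.

Let cons_measure0 : cons_measure set0 = 0.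
Proof. by rewrite /cons_measure /pushforward preimage_set0 measure0. Qed.

Let cons_measure_ge0 A : 0 <= cons_measure A.
Proof. by rewrite /cons_measure /pushforward measure_ge0. Qed.

Let cons_measure_sigma_additive : semi_sigma_additive cons_measure.
Proof.
exact: (@measure_semi_sigma_additive _ _ _
  (measure_function_pushforward__canonical__measure_function_Measure
    ((@lebesgue_measure R) \x m) (@measurable_tcons R k))).
Qed.

HB.instance Definition _ := isMeasure.Build _ _ _ cons_measure
  cons_measure0 cons_measure_ge0 cons_measure_sigma_additive.

Lemma cons_measureX (A : set (measurableTypeR R)) (B : set 'Rn[R]_k) :
  measurable A -> measurable B ->
  cons_measure (tuncons @^-1` (A `*` B)) = lebesgue_measure A * m B.
Proof.
move=> mA mB; rewrite /cons_measure /pushforward preimage_tunconsK.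
exact: product_measure1E.
Qed.

Let cons_measure_sigma_finite : sigma_finite setT cons_measure.
Proof.
have /sigma_finiteP[F [TF ndF Foo]] := sigma_finiteT (@lebesgue_measure R).
have /sigma_finiteP[G [TG ndG Goo]] := sigma_finiteT m.
exists (fun n => tuncons @^-1` (F n `*` G n)).
  rewrite -preimage_bigcup -[LHS](preimage_setT tuncons).
  congr (_ @^-1` _); rewrite -setXTT TF TG predeqE => -[x y]; split.
    move=> [/= [n _ Fnx] [l _ Gly]]; exists (maxn n l) => //; split.
    - by move: x Fnx; exact/subsetPset/ndF/leq_maxl.
    - by move: y Gly; exact/subsetPset/ndG/leq_maxr.
  by move=> [n _ []/= ? ?]; split; exists n.
move=> n; have [? ?] := Foo n; have [? ?] := Goo n; split.
  by apply: measurable_preimage_tuncons; exact: measurableX.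
by rewrite cons_measureX// lte_mul_pinfty// ge0_fin_numE.
Qed.

HB.instance Definition _ := Measure_isSigmaFinite.Build _ _ _ cons_measure
  cons_measure_sigma_finite.

End cons_measure.

(* k-fold product of the Lebesgue measure of R, see lebesgue_Rn_box; on the
   one-point space R^0 it is the unit mass. *)
Fixpoint lebesgue_Rn (R : realType) (k : nat) :
    {sigma_finite_measure set 'Rn[R]_k -> \bar R} :=
  match k with
  | 0 => \d_([tuple] : 'Rn[R]_0)
  | k'.+1 => cons_measure (lebesgue_Rn R k')
  end.

Lemma lebesgue_Rn_box (R : realType) (k : nat)
    (A : 'I_k -> set (measurableTypeR R)) :
  (forall i, measurable (A i)) ->
  lebesgue_Rn R k [set t | forall i, A i (tnth t i)] =
  \prod_(i < k) lebesgue_measure (A i).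
Proof.
elim: k A => [|k IHk] A mA.
  by rewrite big_ord0 /= diracE mem_set// => -[].
rewrite big_ord_recl -(IHk (fun i => A (lift ord0 i)))//.
rewrite -cons_measureX//; last first.
  rewrite (_ : mkset _ = \bigcap_(i in [set: 'I_k])
      ((fun t : 'Rn[R]_k => tnth t i) @^-1` A (lift ord0 i))).
    apply: fin_bigcap_measurable => // i _; rewrite -[X in measurable X]setTI.
    exact: measurable_tnth.
  by apply/seteqP; split => [t At i _|t At i]; apply: At.
congr (cons_measure _ _); apply/seteqP; split => t /=.
  move=> At; split => [|i]; first exact: At.
  by have := At (lift ord0 i); rewrite /= {1}(tuple_eta t) tnthS.
move=> [A0 A1] i; case: (unliftP ord0 i) => [j ->|->//].
by rewrite (tuple_eta t) tnthS; exact: A1.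
Qed.

Section euclidean.
Context (R : realType) (k : nat).
Implicit Types (x y : 'Rn[R]_k) (p q : 'Rn[R]_k -> \bar R).

Definition dot x y : R := (\sum_(i < k) (tnth x i : R) * (tnth y i : R))%R.

Definition enorm x : R := Num.sqrt (dot x x).

Definition vsub x y : 'Rn[R]_k :=
  [tuple ((tnth x i : R) - (tnth y i : R))%R | i < k].

Definition is_density (p : 'Rn[R]_k -> R) :=
  [/\ measurable_fun setT p,
      (forall x, (0 <= p x)%R) &
      \int[lebesgue_Rn R k]_x (p x)%:E = 1].

(* The integral of a nonnegative measurable function always exists in \bar R,
   possibly as +oo, hence the codomain. *)
Definition conv p q : 'Rn[R]_k -> \bar R :=
  fun x => \int[lebesgue_Rn R k]_u (p (vsub x u) * q u).

(* p 0 * p 1 * ... * p (n-1), bracketed to the left; the value for n = 0 is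
   arbitrary. *)
Definition iter_conv (n : nat) (p : 'I_n -> 'Rn[R]_k -> \bar R) :
    'Rn[R]_k -> \bar R :=
  if [seq p i | i <- enum 'I_n] is p0 :: s then foldl conv p0 s else cst 0.

End euclidean.

(* Main.v *)
Require Import Defs.
From mathcomp Require Import all_boot all_order all_algebra.
From mathcomp Require Import all_classical all_reals all_analysis.
From mathcomp Require Import measurable_realfun ring lra.

Import Order.TTheory GRing.Theory Num.Theory.
Import numFieldNormedType.Exports.

Local Open Scope classical_set_scope.
Local Open Scope ring_scope.

(** Only the component of x along e matters, so e is the first basis vector.
    Write eps_i = lambda - mu_i and S = sum_i 1/eps_i.  The density p_i is the
    largest one allowed by the pointwise bound, namely a multiple of
    exp(- mu_i e x), but restricted to a comb: the union over j of small cubes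
    (teeth) centred at (j / eps_i) e.  The tooth number j has the same size for
    all i, with a volume proportional to exp(- (1 + delta) j) where delta > 0 is
    small.  On it exp(lambda e x) p_i is of order exp(eps_i j / eps_i) = exp(j),
    so the exponential moment is bounded by the geometric series of
    exp(- delta j), and each p_i is admissible (exists_comb_density).

    The positions j / eps_i are chosen so that the j-th teeth reinforce each
    other: if p_1, ..., p_n are bounded below by d_1, ..., d_n on cubes of equal
    size, then p_1 * ... * p_n at the sum of the centres is at least
    d_1 ... d_n times the (n-1)-st power of the volume of a cube, up to a factor
    depending on n and k only (iter_conv_ge_cubes).  At x = j S e this gives, up
    to a constant,
      exp(- sum_i mu_i j / eps_i - (1 + delta) (n - 1) j)
        = exp(- lambda j S + j - delta (n - 1) j),
    because mu_i / eps_i = lambda / eps_i - 1.  Dividing by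
    exp(- (lambda - epsd) j S) leaves exp(j (1 - epsd S - delta (n - 1))).  As
    epsd < 1 / S, the exponent is a positive multiple of j once delta is small,
    and no constant K bounds it for all j. *)

(** * Two integral estimates *)

(** This lower estimate needs no measurability of f: the integral of
    a nonnegative function is a supremum over the simple functions below it, and
    a times the indicator of A is one of them.  This is what allows iterated
    convolutions to be bounded from below without showing that they are
    measurable. *)
Lemma mul_measure_le_integral d (T : measurableType d) (R : realType)
    (m : {measure set T -> \bar R}) (f : T -> \bar R) (A : set T) (a : R) :
  measurable A -> 0 <= a -> (forall x, 0 <= f x)%E ->
  (forall x, A x -> a%:E <= f x)%E ->
  (a%:E * m A <= \int[m]_x f x)%E.
Proof.
move=> mA a0 f0 af.
rewrite ge0_integralTE//; apply: ereal_sup_ubound.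
exists (scale_nnsfun (indic_nnsfun R mA) a0) => /=.
  move=> x; rewrite /mindic indicE; case: (boolP (x \in A)) => [/set_mem Ax|_].
    by rewrite mulr1; exact: af.
  by rewrite mulr0; exact: f0.
by rewrite sintegralrM sintegral_indic.
Qed.

(** The integrand on the union is dominated by the series of the step functions
    c_j 1_(F_j), whatever the overlaps, and that series is integrated term by
    term against a geometric one. *)
Lemma integral_bigcup_lt_pinfty d (T : measurableType d) (R : realType)
    (m : {measure set T -> \bar R}) (F : nat -> set T) (f : T -> R)
    (c : nat -> R) (a q : R) :
  (forall j, measurable (F j)) -> measurable_fun setT f ->
  (forall x, 0 <= f x) ->
  (forall j x, F j x -> f x <= c j) -> (forall j, 0 <= c j) ->
  0 <= a -> 0 < q < 1 ->
  (forall j, (c j)%:E * m (F j) <= (a * q ^+ j)%:E)%E ->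
  (\int[m]_(x in \bigcup_j F j) (f x)%:E < +oo)%E.
Proof.
move=> mF mf f0 fc c0 a0 /andP[q0 q1] cF.
have mU : measurable (\bigcup_j F j) by exact: bigcup_measurable.
pose g j x := (c j * \1_(F j) x)%:E : \bar R.
have g0 j x : (0 <= g j x)%E by rewrite lee_fin mulr_ge0.
have mg j : measurable_fun setT (g j).
  apply/measurable_EFinP; exact: measurable_funM.
have -> : (\int[m]_(x in \bigcup_j F j) (f x)%:E =
    \int[m]_x ((EFin \o f) \_ (\bigcup_j F j)) x)%E by rewrite integral_mkcond.
have le_g : (\int[m]_x ((EFin \o f) \_ (\bigcup_j F j)) x <=
    \int[m]_x (\sum_(j <oo) g j x))%E.
  apply: ge0_le_integral => //.
  - by move=> x _; apply: erestrict_ge0 => y _; rewrite lee_fin.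
  - apply/(measurable_restrictT _ mU).
    by apply/measurable_EFinP; exact: measurable_funTS.
  - by apply: ge0_emeasurable_sum => // *; exact: g0.
  - move=> x _; rewrite patchE; case: ifPn => [/set_mem[j _ Fjx]|_]; last first.
      by apply: nneseries_ge0 => *; exact: g0.
    rewrite (nneseriesD1 (n := j))//=; apply: le_trans (leeDl _ _).
      by rewrite /g indicE mem_set// mulr1 lee_fin; exact: fc Fjx.
    by apply: nneseries_ge0 => *; exact: g0.
apply: le_lt_trans le_g _.
rewrite integral_nneseries//.
apply: (@le_lt_trans _ _ (a / (1 - q))%:E); last by rewrite ltry.
have int_g j : (\int[m]_x g j x = (c j)%:E * m (F j))%E.
  rewrite /g (@integralZl_indic _ _ _ _ _ measurableT (fun=> F j))//.
    by rewrite integral_indic// setIT.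
  by move=> cj; move: (c0 j); rewrite leNgt cj.
apply: lime_le.
  by apply: is_cvg_nneseries => j _ _; exact: integral_ge0.
apply: nearW => N.
apply: (@le_trans _ _ (\sum_(0 <= j < N) (a * q ^+ j)%:E)%E).
  by apply: lee_sum => j _; rewrite int_g.
rewrite sumEFin lee_fin.
apply: geometric_le_lim => //; rewrite ger0_norm//; exact: ltW.
Qed.

(** * Cubes centred on the first axis *)

Section cubes.
Variables (R : realType) (k : nat).
Implicit Types (x y : 'Rn[R]_k) (a b r s : R).

Definition axis : 'Rn[R]_k := [tuple ((val l == 0)%N)%:R | l < k].

(** Sup-norm balls with centre a e: their volume is explicit, and their centres
    add under convolution. *)
Definition cube a r : set 'Rn[R]_k :=
  [set x | forall l, `|(tnth x l : R) - a * (tnth axis l : R)| <= r].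

Let side a r (l : 'I_k) : set (measurableTypeR R) :=
  `[a * (tnth axis l : R) - r, a * (tnth axis l : R) + r]%classic.

Let cubeE a r : cube a r = [set x | forall l, side a r l (tnth x l)].
Proof.
apply/seteqP; split => x /= h l; have := h l;
by rewrite /side /= in_itv /= ler_distl.
Qed.

Let measurable_side a r l : measurable (side a r l).
Proof. exact: measurable_itv. Qed.

Lemma measurable_cube a r : measurable (cube a r).
Proof.
have -> : cube a r = \bigcap_(l in [set: 'I_k])
    ((fun t : 'Rn[R]_k => tnth t l) @^-1` side a r l).
  by rewrite cubeE; apply/seteqP; split => [t h l _|t h l]; apply: h.
apply: fin_bigcap_measurable => // l _; rewrite -[X in measurable X]setTI.
exact: measurable_tnth.
Qed.

Lemma lebesgue_cube a r : 0 <= r ->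
  lebesgue_Rn R k (cube a r) = ((2 * r) ^+ k)%:E.
Proof.
move=> r0; rewrite cubeE lebesgue_Rn_box//.
rewrite (eq_bigr (fun=> (2 * r)%:E)) => [|l _].
  by rewrite prodEFin prodr_const card_ord.
rewrite /side lebesgue_measure_itv /= lte_fin; case: ltP => h.
  by rewrite -EFinB; congr EFin; ring.
by rewrite (_ : r = 0) ?mulr0//; lra.
Qed.

(** If x is within r - s of the sum of the centres and u is within s of b e,
    then x - u is within r of a e, so the integrand is at least c d for all u in
    the cube around b e. *)
Lemma conv_ge_cube (p q : 'Rn[R]_k -> \bar R) a b r s (c d : R) :
  (forall x, 0 <= p x)%E -> (forall x, 0 <= q x)%E ->
  0 <= c -> 0 <= d -> 0 <= s ->
  (forall x, cube a r x -> c%:E <= p x)%E ->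
  (forall x, cube b s x -> d%:E <= q x)%E ->
  forall x, cube (a + b) (r - s) x ->
  ((c * (d * (2 * s) ^+ k))%:E <= Defs.conv p q x)%E.
Proof.
move=> p0 q0 c0 d0 s0 cp dq x xab.
rewrite mulrA EFinM -(lebesgue_cube b _ s0); apply: mul_measure_le_integral => //.
- exact: measurable_cube.
- by rewrite mulr_ge0.
- by move=> u; rewrite mule_ge0.
move=> u ub; rewrite EFinM lee_pmul ?lee_fin//; last exact: dq.
apply: cp => l; rewrite tnth_mktuple.
have -> : (tnth x l : R) - (tnth u l : R) - a * (tnth axis l : R) =
  (tnth x l - (a + b) * tnth axis l) - (tnth u l - b * tnth axis l) :> R by ring.
by apply: le_trans (ler_normB _ _) _; have := xab l; have := ub l; lra.
Qed.

(** Each convolution shrinks by t the cube on which the bound is known, while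
    the factors q i keep cubes of the fixed radius t. *)
Lemma foldl_conv_ge_cube (I : Type) (s : seq I) (q : I -> 'Rn[R]_k -> \bar R)
    (p : 'Rn[R]_k -> \bar R) (a r t c : R) (b d : I -> R) :
  (forall x, 0 <= p x)%E -> (forall i x, 0 <= q i x)%E ->
  0 <= c -> (forall i, 0 <= d i) -> 0 <= t ->
  (forall x, cube a r x -> c%:E <= p x)%E ->
  (forall i x, cube (b i) t x -> (d i)%:E <= q i x)%E ->
  forall x, cube (a + \sum_(i <- s) b i) (r - (size s)%:R * t) x ->
  ((c * (\prod_(i <- s) d i * ((2 * t) ^+ k) ^+ size s))%:E
     <= foldl (@Defs.conv R k) p [seq q i | i <- s] x)%E.
Proof.
move=> p0 q0 c0 d0 t0 cp dq.
elim: s p a r c p0 c0 cp => [|i s IHs] p a r c p0 c0 cp x.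
  by rewrite !big_nil addr0 mul0r subr0 !mulr1 => /cp.
rewrite !big_cons /= => xs.
have -> : c * (d i * \prod_(j <- s) d j * ((2 * t) ^+ k) ^+ (size s).+1) =
  c * (d i * (2 * t) ^+ k) * (\prod_(j <- s) d j * ((2 * t) ^+ k) ^+ size s).
  by rewrite exprS; ring.
apply: (IHs (Defs.conv p (q i)) (a + b i) (r - t)).
- by move=> y; apply: integral_ge0 => u _; rewrite mule_ge0.
- by rewrite !mulr_ge0// exprn_ge0// mulr_ge0.
- by apply: conv_ge_cube => //; exact: dq.
- move: xs; rewrite addrA; congr (cube _ _ _).
  by rewrite -natr1; ring.
Qed.

(** The first factor uses its full radius r and each of the n - 1 others only
    r / n: then the bound survives n - 1 shrinkings, at least at the centre. *)
Lemma iter_conv_ge_cubes (n : nat) (p : 'I_n -> 'Rn[R]_k -> \bar R)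
    (b d : 'I_n -> R) (r : R) :
  (0 < n)%N -> 0 <= r -> (forall i x, 0 <= p i x)%E -> (forall i, 0 <= d i) ->
  (forall i x, cube (b i) r x -> (d i)%:E <= p i x)%E ->
  ((\prod_i d i * ((2 * (r / n%:R)) ^+ k) ^+ n.-1)%:E <=
   iter_conv p [tuple ((\sum_i b i) * tnth axis l)%R | l < k])%E.
Proof.
move=> n0 r0 p0 d0 dp.
rewrite -[\prod_i _]big_enum -[\sum_i _]big_enum /iter_conv.
have := size_enum_ord n.
case: (enum 'I_n) => [En|i s]; first by rewrite -En in n0.
move=> /= sn; rewrite !big_cons -mulrA.
have tr : r / n%:R <= r.
  by rewrite ler_piMr// invf_le1 ?ltr0n// ler1n.
have t0 : 0 <= r / n%:R by rewrite divr_ge0.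
have -> : n.-1 = size s by apply: succn_inj; rewrite sn prednK.
apply: (@foldl_conv_ge_cube _ _ _ _ (b i) r _ (d i) b) => //.
- exact: dp.
- move=> j x xj; apply: dp => l; exact: le_trans (xj l) tr.
- move=> l; rewrite tnth_mktuple subrr normr0 subr_ge0.
  rewrite mulrCA ler_piMr// ler_pdivrMr ?ltr0n// mul1r ler_nat -[X in (_ <= X)%N]sn.
  exact: leqnSn.
Qed.

Lemma measurable_dot (e : 'Rn[R]_k) : measurable_fun setT (dot e).
Proof.
apply: measurable_sum => l.
by apply: measurable_funM => //; exact: measurable_tnth.
Qed.

End cubes.

Arguments axis {R}.
Arguments cube {R}.

Lemma dot_axis (R : realType) (k : nat) (x : 'Rn[R]_k.+1) :
  dot (axis k.+1) x = tnth x ord0.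
Proof.
rewrite /dot big_ord_recl big1 ?addr0 => [|l _].
  by rewrite tnth_mktuple /= mul1r.
by rewrite tnth_mktuple /= mul0r.
Qed.

Lemma enorm_axis (R : realType) (k : nat) : enorm (axis k.+1) = 1 :> R.
Proof. by rewrite /enorm dot_axis tnth_mktuple sqrtr1. Qed.

Lemma dot_cube (R : realType) (k : nat) (a r : R) (x : 'Rn[R]_k.+1) :
  cube k.+1 a r x -> a - r <= dot (axis k.+1) x <= a + r.
Proof.
move=> /(_ ord0); rewrite dot_axis tnth_mktuple /= mulr1.
by rewrite ler_distl.
Qed.

(** * A density concentrated on a comb *)

Section comb.
Variables (R : realType) (k : nat) (eps delta : R).
Hypotheses (eps0 : 0 < eps) (delta0 : 0 < delta).

Local Notation e := (axis k.+1).

(** The radius is the one for which the volume is 2^(k+1) exp(-(1+delta) j): it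
    depends on j but not on eps, hence is common to all factors. *)
Definition tooth (j : nat) : set 'Rn[R]_k.+1 :=
  cube k.+1 (j%:R / eps) (expR (- ((1 + delta) * j%:R / k.+1%:R))).

Definition comb : set 'Rn[R]_k.+1 := \bigcup_j tooth j.

Lemma measurable_tooth j : measurable (tooth j).
Proof. exact: measurable_cube. Qed.

Lemma measurable_comb : measurable comb.
Proof. by apply: bigcup_measurable => j _; exact: measurable_tooth. Qed.

Lemma lebesgue_tooth j :
  lebesgue_Rn R k.+1 (tooth j) =
  (2 ^+ k.+1 * expR (- (1 + delta) * j%:R))%:E.
Proof.
rewrite (lebesgue_cube _ _ _ _ (expR_ge0 _)); congr EFin.
rewrite exprMn -expRM_natl; congr (_ * expR _).
by field; rewrite addrC natr1 pnatr_eq0.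
Qed.

Lemma dot_tooth j x : tooth j x -> j%:R / eps - 1 <= dot e x <= j%:R / eps + 1.
Proof.
move=> /dot_cube/andP[h1 h2].
suff : expR (- ((1 + delta) * j%:R / k.+1%:R)) <= 1 by lra.
by rewrite expR_le1 oppr_le0 !(divr_ge0, mulr_ge0)// addr_ge0// ltW.
Qed.

(** A linear exponent that stays below j + C on the tooth j makes its
    contribution at most exp(j + C) times the volume, a multiple of
    exp(- delta j).  Both the normalising constant (theta = - mu) and the
    exponential moment (theta = eps) are of this kind. *)
Lemma integral_comb_lt_pinfty (theta C : R) :
  (forall j x, tooth j x -> theta * dot e x <= j%:R + C) ->
  (\int[lebesgue_Rn R k.+1]_(x in comb) (expR (theta * dot e x))%:E < +oo)%E.
Proof.
move=> hC.
apply: (@integral_bigcup_lt_pinfty _ _ _ _ _ _ (fun j => expR (j%:R + C))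
  (2 ^+ k.+1 * expR C) (expR (- delta))).
- exact: measurable_tooth.
- apply: measurableT_comp => //; apply: measurable_funM => //.
  exact: measurable_dot.
- by move=> x; exact: expR_ge0.
- by move=> j x xj; rewrite ler_expR; exact: hC.
- by move=> j; exact: expR_ge0.
- by rewrite mulr_ge0 ?expR_ge0// exprn_ge0.
- by rewrite expR_gt0 expR_lt1 oppr_lt0.
move=> j; rewrite [X in (_ * X)%E]lebesgue_tooth -EFinM lee_fin.
rewrite -expRM_natl mulrCA -!mulrA -!expRD.
rewrite ler_pM2l ?exprn_gt0// ler_expR; lra.
Qed.

Variables (lambda mu : R).
Hypotheses (mu0 : 0 <= mu) (eps_eq : eps = lambda - mu).

Let w x : R := expR (- mu * dot e x).

Let mw : measurable_fun setT w.
Proof.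
apply: measurableT_comp => //; apply: measurable_funM => //.
exact: measurable_dot.
Qed.

Let Z := (\int[lebesgue_Rn R k.+1]_(x in comb) (w x)%:E)%E.

Let w_tooth j x : tooth j x -> expR (- mu) * expR (- mu * (j%:R / eps)) <= w x.
Proof.
move=> /dot_tooth/andP[_ h]; rewrite -expRD ler_expR -{1}[- mu]mulr1 -mulrDr.
by rewrite ler_wnM2l ?oppr_le0// addrC.
Qed.

Let Z_lt_pinfty : (Z < +oo)%E.
Proof.
apply: (@integral_comb_lt_pinfty _ mu) => j x /dot_tooth/andP[h _].
apply: (@le_trans _ _ (- mu * - 1)); last by rewrite mulrN1 opprK lerDr.
rewrite ler_wnM2l ?oppr_le0// (le_trans _ h)// lerBDr addNr.
by rewrite divr_ge0// ltW.
Qed.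

Let Z_gt0 : (0 < Z)%E.
Proof.
apply: (@lt_le_trans _ _ ((expR (- mu))%:E * lebesgue_Rn R k.+1 (tooth 0))%E).
  by rewrite [X in (_ * X)%E]lebesgue_tooth -EFinM lte_fin !mulr_gt0 ?expR_gt0// exprn_gt0.
rewrite /Z integral_mkcond; apply: mul_measure_le_integral.
- exact: measurable_tooth.
- exact: expR_ge0.
- by move=> x; apply: erestrict_ge0 => y _; rewrite lee_fin expR_ge0.
move=> x x0; rewrite patchE mem_set; last by exists 0%N.
by rewrite lee_fin; have := w_tooth 0%N x x0; rewrite mul0r mulr0 expR0 mulr1.
Qed.

Let z := fine Z.
Let zE : z%:E = Z.
Proof. by rewrite fineK// ge0_fin_numE// ltW. Qed.
Let z0 : 0 < z. Proof. by rewrite -lte_fin zE. Qed.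

(** The density is exp(- mu e x) on the comb, normalised.  Multiplying it by
    exp(lambda e x) gives exp(eps e x), which is of order exp(j) on the tooth
    j. *)
Lemma exists_comb_density : exists p : 'Rn[R]_k.+1 -> R,
  [/\ is_density p,
      (\int[lebesgue_Rn R k.+1]_x (expR (lambda * dot e x) * p x)%:E < +oo)%E,
      (exists C : R, 0 < C /\ forall x, p x <= C * expR (- mu * dot e x)) &
      (exists c : R, 0 < c /\ forall j x, tooth j x ->
         c * expR (- mu * (j%:R / eps)) <= p x)].
Proof.
exists (fun x => z^-1 * (w \_ comb) x).
have intE (f : 'Rn[R]_k.+1 -> R) : measurable_fun setT f -> (forall x, 0 <= f x) ->
    (\int[lebesgue_Rn R k.+1]_x (z^-1 * (f \_ comb) x)%:E =
     (z^-1)%:E * \int[lebesgue_Rn R k.+1]_(x in comb) (f x)%:E)%E.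
  move=> mf f0.
  under eq_integral do rewrite EFinM.
  rewrite [in RHS]integral_mkcond ge0_integralZl_EFin//.
  - by congr (_ * _)%E; apply: eq_integral => x _; rewrite !patchE; case: ifP.
  - by move=> x _; rewrite lee_fin patchE; case: ifP.
  - apply/measurable_EFinP; apply/(measurable_restrictT _ measurable_comb).
    exact: measurable_funTS.
  - by rewrite invr_ge0 ltW.
split.
- split.
  + apply: measurable_funM => //.
    apply/(measurable_restrictT _ measurable_comb); exact: measurable_funTS.
  + move=> x; rewrite mulr_ge0 ?invr_ge0 ?(ltW z0)// patchE.
    by case: ifP => // _; exact: expR_ge0.
  + rewrite intE//; last by move=> x; exact: expR_ge0.
    by rewrite -/Z -zE -EFinM mulVf// gt_eqF.
- under eq_integral => x _.
    rewrite (_ : expR _ * _ = z^-1 * ((fun x => expR (eps * dot e x)) \_ comb) x);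
      last first.
      rewrite !patchE; case: ifP => _; last by rewrite !mulr0.
      by rewrite mulrCA -expRD eps_eq mulNr -mulrBl.
    over.
  rewrite intE; last 2 first.
  + apply: measurableT_comp => //; apply: measurable_funM => //.
    exact: measurable_dot.
  + by move=> x; exact: expR_ge0.
  apply: lte_mul_pinfty => //; first by rewrite lee_fin invr_ge0 ltW.
  apply: (@integral_comb_lt_pinfty _ eps) => j x /dot_tooth/andP[_ h].
  have -> : j%:R + eps = eps * (j%:R / eps + 1).
    by rewrite mulrDr mulr1 mulrCA divff ?mulr1// gt_eqF.
  by rewrite ler_pM2l.
- exists z^-1; split => [|x]; first by rewrite invr_gt0.
  rewrite ler_pM2l ?invr_gt0// patchE; case: ifP => // _; exact: expR_ge0.
- exists (z^-1 * expR (- mu)); split => [|j x xj].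
    by rewrite mulr_gt0 ?invr_gt0 ?expR_gt0.
  rewrite -mulrA ler_pM2l ?invr_gt0// patchE mem_set; last by exists j.
  exact: w_tooth.
Qed.

End comb.

(** * The growth of the convolution *)

Lemma exp_growth_unbounded (R : realType) (g eta K : R) : 0 < g -> 0 < eta ->
  ~ (forall j : nat, g * expR (j%:R * eta) <= K).
Proof.
move=> g0 eta0 gK.
have ge0 : 0 < g * eta by rewrite mulr_gt0.
have := gK (Num.bound `|K / (g * eta)|).
apply/negP; rewrite -ltNge.
have hK : K < (Num.bound `|K / (g * eta)|)%:R * (g * eta).
  rewrite -ltr_pdivrMr//; apply: le_lt_trans (ler_norm _) _.
  by apply: archi_boundP.
apply: (lt_le_trans hK); rewrite mulrCA ler_pM2l//.
by apply: le_trans (expR_ge1Dx _); rewrite lerDr.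
Qed.

Theorem proposition2p2 (R : realType) (k n : nat) (hk : (1 <= k)%N)
    (hn : (1 <= n)%N) (lambda : R) (hlambda : 0 < lambda) (mu : 'I_n -> R)
    (hmu : forall i, 0 <= mu i < lambda) :
  let eps (i : 'I_n) := lambda - mu i in
  let epsn := 1 / \sum_(i < n) 1 / eps i in
  forall epsd : R, epsd < epsn ->
  exists (e : 'Rn[R]_k) (p : 'I_n -> 'Rn[R]_k -> R),
    enorm e = 1 /\
    (forall i, is_density (p i)) /\
    (forall i,
      (\int[lebesgue_Rn R k]_x (expR (lambda * dot e x) * p i x)%:E < +oo)%E /\
      (exists C : R, 0 < C /\
        forall x, p i x <= C * expR (- mu i * dot e x))) /\
    ~ (exists K : R, forall x,
        (iter_conv (fun i y => (p i y)%:E) x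
           <= (K * expR (- (lambda - epsd) * dot e x))%:E)%E).
Proof.
case: k hk => // k _ eps epsn epsd lt_epsd.
have eps0 i : 0 < eps i by rewrite subr_gt0; case/andP: (hmu i).
have n0 : 0 < n%:R :> R by rewrite ltr0n.
pose S : R := \sum_(i < n) (eps i)^-1.
have SE : \sum_(i < n) 1 / eps i = S by apply: eq_bigr => i _; rewrite div1r.
have S0 : 0 < S.
  rewrite /S; case: (n) hn (eps) eps0 => // m _ h h0.
  rewrite big_ord_recl ltr_pwDl ?invr_gt0// sumr_ge0// => i _.
  by rewrite invr_ge0 ltW.
pose gap := 1 - epsd * S.
have gap0 : 0 < gap.
  by rewrite subr_gt0 -ltr_pdivlMr// -SE.
(* Small enough for delta (n - 1) to use up less than half of the gap. *)
pose delta := gap / (2 * n%:R).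
have delta0 : 0 < delta by rewrite divr_gt0// mulr_gt0.
have /choice[p hp] i := exists_comb_density R k (eps i) delta (eps0 i) delta0
  lambda (mu i) (andP (hmu i)).1 erefl.
exists (axis k.+1), p; split; first exact: enorm_axis.
split; first by move=> i; case: (hp i).
split; first by move=> i; case: (hp i).
have /choice[c hc] i : exists c, 0 < c /\ forall j x, tooth R k (eps i) delta j x ->
    c * expR (- mu i * (j%:R / eps i)) <= p i x by case: (hp i).
move=> [K hK].
have c0 i : 0 < c i by case: (hc i).
pose A : R := ((2 / n%:R) ^+ k.+1) ^+ n.-1.
apply: (@exp_growth_unbounded _ (\prod_i c i * A) (gap / 2) K).
- rewrite mulr_gt0 ?exprn_gt0 ?divr_gt0//.
  by apply: prodr_gt0 => i _; exact: c0.
- by rewrite divr_gt0.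
move=> j.
pose b i : R := j%:R / eps i.
pose x : 'Rn[R]_k.+1 := [tuple ((\sum_i b i) * tnth (axis k.+1) l)%R | l < k.+1].
have dx : dot (axis k.+1) x = j%:R * S.
  by rewrite dot_axis !tnth_mktuple mulr1 /S mulr_sumr.
pose r : R := expR (- ((1 + delta) * j%:R / k.+1%:R)).
have := hK x; rewrite dx => le_x.
have lower : ((\prod_i (c i * expR (- mu i * b i)) *
    ((2 * (r / n%:R)) ^+ k.+1) ^+ n.-1)%:E <=
    iter_conv (fun i y => (p i y)%:E) x)%E.
  apply: iter_conv_ge_cubes => //.
  - exact: expR_ge0.
  - by move=> i y; rewrite lee_fin; case: (hp i) => -[].
  - by move=> i; rewrite mulr_ge0 ?expR_ge0// ltW.
  - by move=> i y yi; rewrite lee_fin; apply: (hc i).2.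
have := le_trans lower le_x; rewrite lee_fin.
have -> : \prod_i (c i * expR (- mu i * b i)) *
    ((2 * (r / n%:R)) ^+ k.+1) ^+ n.-1 =
  (\prod_i c i * A) *
    expR (j%:R * (n%:R - (1 + delta) * n.-1%:R) - lambda * (j%:R * S)).
  rewrite big_split /= -expR_sum.
  have -> : (2 * (r / n%:R)) ^+ k.+1 =
      (2 / n%:R) ^+ k.+1 * expR (- ((1 + delta) * j%:R)).
    rewrite mulrCA exprMn mulrC -expRM_natl; congr (_ * expR _).
    by field; rewrite addrC natr1 pnatr_eq0.
  rewrite exprMn -/A -expRM_natl.
  rewrite mulrACA -expRD; congr (_ * expR _).
  (* This uses mu_i / eps_i = lambda / eps_i - 1. *)
  have -> : \sum_i - mu i * b i = j%:R * n%:R - lambda * (j%:R * S).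
    transitivity (\sum_(i < n) (j%:R - lambda * (j%:R * (eps i)^-1))).
      apply: eq_bigr => i _; rewrite /b.
      have -> : mu i = lambda - eps i by rewrite /eps; ring.
      by field; rewrite gt_eqF.
    by rewrite sumrB sumr_const card_ord -mulr_sumr -mulr_sumr mulr_natr.
  by ring.
(* Both sides carry exp(- (lambda - epsd) j S); only the growth rate is left. *)
move=> h.
have {}h : \prod_i c i * A *
    expR (j%:R * (n%:R - (1 + delta) * n.-1%:R - epsd * S)) <= K.
  rewrite -(ler_pM2r (expR_gt0 (- (lambda - epsd) * (j%:R * S)))) -[leLHS]mulrA -expRD.
  by move: h; congr (_ * expR _ <= _); ring.
apply: (le_trans _ h); rewrite ler_wpM2l//.
  rewrite mulr_ge0 ?exprn_ge0 ?divr_ge0//.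
  by apply: prodr_ge0 => i _; exact: ltW.
rewrite ler_expR ler_wpM2l//.
have -> : n.-1%:R = n%:R - 1 :> R by rewrite -[in RHS](prednK hn) -natr1 addrK.
have -> : n%:R - (1 + delta) * (n%:R - 1) - epsd * S = gap / 2 + delta.
  by rewrite /delta /gap; field; rewrite gt_eqF.
by rewrite lerDl ltW.
Qed.
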